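(* Let $\lambda/\mu$ be an edgewise connected skew shape with $d$ diagonals. Then there is a one-to-one correspondence between the outside decompositions of $\lambda/\mu$ and the border strips with $d$ boxes, namely the map sending each outside decomposition $\Pi$ of $\lambda/\mu$ to its cutting strip.
   Context: Skew shapes. For partitions $\lambda=(\lambda_1\ge\dots\ge\lambda_k\ge 0)$, $\mu=(\mu_1\ge\dots\ge\mu_k\ge 0)$ with $\mu_i\le\lambda_i$ for all $i$, the skew diagram (skew shape) $\lambda/\mu$ is the set of boxes $(i,j)\in\mathbb{Z}^2$ with $1\le i\le k$, $\mu_i<j\le\lambda_i$; box $(i,j)$ lies in row $i$ from the top and column $j$ from the left. Two boxes are edgewise connected if they share a common edge; the diagram is edgewise connected if it is a (nonempty) connected set under this adjacency. The content of $(i,j)$ is $j-i$; a diagonal with content $c$ is the set of all boxes of $\lambda/\mu$ with content $c$ (only nonempty diagonals are counted). Diagonals are ordered by increasing content: the $i$-th diagonal is the one with the $i$-th smallest content. Border strips. A (border) strip is an edgewise connected skew diagram (considered up to translation when regarded as an abstract shape) containing no $2\times2$ block of boxes. Its starting box is the box at its lower left end, its ending box is at its upper right end, and boxes are ordered by increasing content. A box that is not the ending box goes right if the next box is to its right, and goes up if the next box is above it. Outside decompositions. A border strip decomposition of $\lambda/\mu$ is a partition of its boxes into pairwise disjoint strips (an unordered collection). It is an outside decomposition if every strip has its starting box on the left or bottom perimeter of $\lambda/\mu$ (its left or lower neighbour is not in $\lambda/\mu$) and its ending box on the right or top perimeter of $\lambda/\mu$ (its right or upper neighbour is not in $\lambda/\mu$).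 Directions. Given an outside decomposition $\Pi$ of $\lambda/\mu$ and a box $b$ belonging to the strip $\theta\in\Pi$: if $b$ is not the ending box of $\theta$, $b$ goes right (resp. up) in $\lambda/\mu$ if it goes right (resp. up) in $\theta$. If $b$ is the ending box of $\theta$, then $b$ goes up if it is on the top perimeter of $\lambda/\mu$ (including when it is a corner, i.e. also on the right perimeter), and otherwise (it is on the right perimeter) it goes right. It is a known fact (Hamel and Goulden's nested property) that for any outside decomposition the boxes on the same diagonal of $\lambda/\mu$ all go up or all go right. Cutting strip. For an outside decomposition $\Pi$ of an edgewise connected skew shape $\lambda/\mu$ with $d$ diagonals, the cutting strip of $\Pi$ is the border strip with $d$ boxes such that, for $i=1,\dots,d-1$, its $i$-th box goes right or goes up according to whether the boxes in the $i$-th diagonal of $\lambda/\mu$ go right or go up with respect to $\Pi$. *)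

(* Defs.v *)
From mathcomp Require Import all_boot all_order all_algebra.
From mathcomp Require Import finmap.
From mathcomp Require Import classical_sets functions.

Set Implicit Arguments.
Unset Strict Implicit.
Unset Printing Implicit Defensive.

Import Order.TTheory GRing.Theory Num.Theory.

Local Open Scope fset_scope.
Local Open Scope ring_scope.

(* Matrix convention: (i, j) is the box in row i (counted from the top) and
   column j (counted from the left). *)
Definition box : Type := (int * int)%type.

Definition content (b : box) : int := b.2 - b.1.

Definition right_of (b : box) : box := (b.1, b.2 + 1).
Definition left_of (b : box) : box := (b.1, b.2 - 1).
Definition above (b : box) : box := (b.1 - 1, b.2).
Definition below (b : box) : box := (b.1 + 1, b.2).

Definition share_edge (a b : box) : bool :=
  b \in [:: right_of a; left_of a; above a; below a].

(* Trailing zero parts are allowed. *)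
Definition is_partition (s : seq nat) : bool := sorted geq s.

(* Same number k of parts, and mu_i <= lambda_i for all i. *)
Definition contained (mu lam : seq nat) : bool := all2 leq mu lam.

(* Rows are numbered from 1, so part number i is the entry i.-1 of the list. *)
Definition skew_diagram (lam mu : seq nat) : {fset box} :=
  [fset b in [seq (i%:Z, j%:Z) | i <- index_iota 1 (size lam).+1,
      j <- index_iota (nth 0%N mu i.-1).+1 (nth 0%N lam i.-1).+1]].

Definition translate (v : box) (A : {fset box}) : {fset box} :=
  [fset b + v | b in A].

Definition translation_class (A : {fset box}) : set {fset box} :=
  [set B | exists v : box, B = translate v A]%classic.

(* A skew diagram, placed anywhere in Z x Z. *)
Definition is_skew_shape (A : {fset box}) : Prop :=
  exists lam mu : seq nat,
    [/\ is_partition lam, is_partition mu, contained mu lam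
      & translation_class (skew_diagram lam mu) A].

Definition edgewise_connected (A : {fset box}) : Prop :=
  A != fset0 /\
  forall x y : A, connect [rel u v : A | share_edge (val u) (val v)] x y.

Definition has_2x2_block (A : {fset box}) : Prop :=
  exists b : box,
    [&& b \in A, right_of b \in A, below b \in A & right_of (below b) \in A].

Definition contents (A : {fset box}) : {fset int} := [fset content b | b in A].

Definition num_diagonals (A : {fset box}) : nat := #|` contents A|.

(* Diagonals are numbered from 0 here: diagonal A i consists of the boxes whose
   content is the (i+1)-st smallest one. *)
Definition diagonal (A : {fset box}) (i : nat) : {fset box} :=
  [fset b in A | content b == nth 0 (sort <=%R (contents A)) i].

Definition border_strip (S : {fset box}) : Prop :=
  [/\ is_skew_shape S, edgewise_connected S & ~ has_2x2_block S].

(* Ordered by increasing content; the boxes of a border strip have pairwise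
   distinct contents. *)
Definition strip_boxes (S : {fset box}) : seq box :=
  sort (relpre content <=%R) S.

Definition strip_box (S : {fset box}) (i : nat) : box :=
  nth 0 (strip_boxes S) i.

Definition starting_box (S : {fset box}) : box := head 0 (strip_boxes S).
Definition ending_box (S : {fset box}) : box := last 0 (strip_boxes S).

Definition next_box (S : {fset box}) (b : box) : box :=
  strip_box S (index b (strip_boxes S)).+1.

Definition strip_goes_right (S : {fset box}) (b : box) : bool :=
  [&& b \in S, b != ending_box S & next_box S b == right_of b].

Definition strip_goes_up (S : {fset box}) (b : box) : bool :=
  [&& b \in S, b != ending_box S & next_box S b == above b].

Definition on_left_perimeter (A : {fset box}) (b : box) : bool :=
  (b \in A) && (left_of b \notin A).
Definition on_bottom_perimeter (A : {fset box}) (b : box) : bool :=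
  (b \in A) && (below b \notin A).
Definition on_right_perimeter (A : {fset box}) (b : box) : bool :=
  (b \in A) && (right_of b \notin A).
Definition on_top_perimeter (A : {fset box}) (b : box) : bool :=
  (b \in A) && (above b \notin A).

Definition strip_decomposition
    (A : {fset box}) (Pi : {fset {fset box}}) : Prop :=
  [/\ forall S, S \in Pi -> border_strip S, trivIfset Pi & fcover Pi = A].

Definition outside_decomposition
    (A : {fset box}) (Pi : {fset {fset box}}) : Prop :=
  strip_decomposition A Pi /\
  forall S, S \in Pi ->
    (on_left_perimeter A (starting_box S) ||
       on_bottom_perimeter A (starting_box S)) /\
    (on_right_perimeter A (ending_box S) ||
       on_top_perimeter A (ending_box S)).

Definition goes_up
    (A : {fset box}) (Pi : {fset {fset box}}) (b : box) : Prop :=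
  exists S, [/\ S \in Pi, b \in S
    & if b == ending_box S then on_top_perimeter A b else strip_goes_up S b].

Definition goes_right
    (A : {fset box}) (Pi : {fset {fset box}}) (b : box) : Prop :=
  exists S, [/\ S \in Pi, b \in S
    & if b == ending_box S
      then on_right_perimeter A b && ~~ on_top_perimeter A b
      else strip_goes_right S b].

(* A cutting strip is an abstract border strip, i.e. one considered up to
   translation, so it is encoded as the set of all its placements in Z x Z.
   That this set is exactly one translation class is not built in. *)
Definition cutting_strip
    (A : {fset box}) (Pi : {fset {fset box}}) : set {fset box} :=
  [set S | [/\ border_strip S, #|` S| = num_diagonals A
    & forall i : nat, (i.+1 < num_diagonals A)%N ->
      forall b, b \in diagonal A i ->
        (strip_goes_right S (strip_box S i) <-> goes_right A Pi b) /\
        (strip_goes_up S (strip_box S i) <-> goes_up A Pi b)]]%classic.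

Definition outside_decompositions (A : {fset box}) : set {fset {fset box}} :=
  [set Pi | outside_decomposition A Pi]%classic.

Definition abstract_border_strips (d : nat) : set (set {fset box}) :=
  [set C | exists S : {fset box},
     [/\ border_strip S, #|` S| = d & C = translation_class S]]%classic.

(* Main.v *)
Require Import Defs.
From mathcomp Require Import all_boot all_order all_algebra.
From mathcomp Require Import finmap.
From mathcomp Require Import classical_sets functions.
From mathcomp Require Import boolp zify.

(** Two observations carry the proof.

    A border strip is a lattice path.  A skew shape is convex for the product
    order on boxes, so two boxes of the same content enclose a 2x2 block unless
    they coincide; together with connectedness this makes the boxes of a border
    strip, listed by content, a walk whose steps go right or up
    ([strip_boxes_ribbon]).  Conversely every such walk is a border strip
    ([ribbon_border_strip]), so an abstract border strip with [d] boxes is just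
    a word of [d - 1] turns.

    In an outside decomposition the turns depend on the content only.  Let [b]
    and [b'] be consecutive boxes on a diagonal, [b'] being the lower right one.
    The box [c] to the right of [b] lies above [b'] and, by convexity, in the
    shape.  It has a left and a lower neighbour, so it starts no strip and is
    therefore entered from [b] or from [b'], but not from both, since a strip
    meets a diagonal at most once.  Hence [b] goes up if and only if [b'] does
    ([goes_up_next_on_diagonal]).  The cutting strip is then the walk which makes
    these turns, and it is determined up to translation
    ([cutting_strip_translation_class]).

    The turns determine which neighbouring boxes lie in a common strip, and the
    strips, being connected, are determined by that; this is injectivity.  For
    surjectivity, a given word of turns makes every box point to a successor,
    and this successor map is a bijection of the plane because its turn depends
    on the content only.  Cutting its orbits where they leave the shape gives
    strips that begin and end on the perimeter ([maximal_chains_outside]).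
    Their directions are the given turns: the convention that a corner goes up
    can contradict them only at a corner which is not on the last diagonal,
    and a connected shape has no such corner ([inner_not_corner]). *)

Set Implicit Arguments.
Unset Strict Implicit.
Unset Printing Implicit Defensive.

Import Order.TTheory GRing.Theory Num.Theory.

Local Open Scope fset_scope.
Local Open Scope ring_scope.

(** * Boxes, contents and steps *)

Lemma box_ext (a b : box) : a.1 = b.1 -> a.2 = b.2 -> a = b.
Proof. by case: a b => [a1 a2] [b1 b2] /= -> ->. Qed.

Lemma boxE (a b : box) : ((a + b).1 = a.1 + b.1) * ((a + b).2 = a.2 + b.2) *
  ((a - b).1 = a.1 - b.1) * ((a - b).2 = a.2 - b.2).
Proof. by []. Qed.

Lemma content_row_inj (a b : box) : content a = content b -> a.1 = b.1 -> a = b.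
Proof. by rewrite /content => cab ab1; apply: box_ext; lia. Qed.

Lemma right_ofK : cancel right_of left_of.
Proof. by move=> b; apply: box_ext => //=; rewrite addrK. Qed.

Lemma left_ofK : cancel left_of right_of.
Proof. by move=> b; apply: box_ext => //=; rewrite subrK. Qed.

Lemma aboveK : cancel above below.
Proof. by move=> b; apply: box_ext => //=; rewrite subrK. Qed.

Lemma belowK : cancel below above.
Proof. by move=> b; apply: box_ext => //=; rewrite addrK. Qed.

Definition right_of_inj := can_inj right_ofK.
Definition above_inj := can_inj aboveK.

Definition step (a b : box) : bool := (b == right_of a) || (b == above a).

Lemma content_right a : content (right_of a) = content a + 1.
Proof. rewrite /content /=; lia. Qed.

Lemma content_above a : content (above a) = content a + 1.
Proof. rewrite /content /=; lia. Qed.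

Lemma content_step a b : step a b -> content b = content a + 1.
Proof. by case/orP=> /eqP->; rewrite ?content_right ?content_above. Qed.

Lemma right_neq_above a : right_of a != above a.
Proof. by apply/eqP => -[]; lia. Qed.

Lemma share_edgeE a b : share_edge a b = step a b || step b a.
Proof.
rewrite /share_edge /step !inE; case: a b => [a1 a2] [b1 b2].
rewrite /right_of /left_of /above /below /= !xpair_eqE; lia.
Qed.

(** * Connectedness and convexity *)

(** Connectedness is used only in this form: a property which every step inside
    the set preserves both ways is constant on the set. *)
Lemma edgewise_connectedP (A : {fset box}) :
  edgewise_connected A <->
  A != fset0 /\ forall P : pred box,
    {in A &, forall x y, step x y -> P x = P y} ->
    {in A &, forall x y, P x = P y}.
Proof.
split=> -[A0 conn]; split=> //.
  move=> P Pstep x y xA yA.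
  have [p pth lst] := connectP (conn [` xA] [` yA]).
  rewrite -[x]/(val [` xA]) -[y]/(val [` yA]) lst.
  elim: p [` xA] pth {lst} => //= z p IH t /andP[tz /IH <-].
  move: tz; rewrite share_edgeE => /orP[] /Pstep-> //; exact: fsvalP.
move=> x y.
(* Conversely, being reachable from x is a property preserved by steps. *)
pose reach := connect [rel u v : A | share_edge (val u) (val v)] x.
pose P (z : box) := [exists t : A, (val t == z) && reach t].
have PE (t : A) : P (val t) = reach t.
  apply/existsP/idP; last by move=> xt; exists t; rewrite eqxx.
  by case=> u /andP[/eqP/val_inj->].
have /(_ (val x) (val y) (fsvalP x) (fsvalP y)) : {in A &, forall x y, P x = P y}.
  apply: conn => u v uA vA uv.
  rewrite -[u]/(val [` uA]) -[v]/(val [` vA]) !PE.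
  apply/idP/idP => /connect_trans; apply; apply: connect1 => /=.
    by rewrite share_edgeE uv.
  by rewrite share_edgeE uv orbT.
by rewrite !PE /reach connect0 => <-.
Qed.

(** Otherwise no step inside [A] would leave the boxes of content at most [c],
    and these would be a union of connected components. *)
Lemma connected_crossing (A : {fset box}) (c : int) a b :
    edgewise_connected A -> a \in A -> b \in A ->
    content a <= c -> c < content b ->
  exists x y : box, [/\ x \in A, y \in A, step x y, content x = c & content y = c + 1].
Proof.
move=> /edgewise_connectedP[_ conn] aA bA ac cb.
apply: contrapT => none.
have /(_ a b aA bA) : {in A &, forall x y, (content x <= c) = (content y <= c)}.
  apply: (conn (fun x => content x <= c)) => x y xA yA xy.
  have yx := content_step xy.
  have xc : content x <> c.
    by move=> xc; apply: none; exists x, y; split=> //; rewrite yx xc.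
  by rewrite yx; lia.
lia.
Qed.

Definition order_convex (A : {fset box}) : Prop :=
  forall a b x : box, a \in A -> b \in A -> a.1 <= x.1 <= b.1 -> a.2 <= x.2 <= b.2 ->
  x \in A.

Lemma in_skew_diagramP (lam mu : seq nat) (b : box) :
  reflect (exists i j : nat, [/\ (i < size lam)%N,
             (nth 0%N mu i < j <= nth 0%N lam i)%N & b = (i.+1%:Z, j%:Z)])
          (b \in skew_diagram lam mu).
Proof.
rewrite /skew_diagram in_fset /=.
apply: (iffP allpairsPdep) => [[i [j [+ + ->]]] | [i [j [ilam jb ->]]]].
  rewrite !mem_index_iota => i_in j_in; exists i.-1, j; split=> //; try lia.
  by congr (_ , _); lia.
by exists i.+1, j; rewrite !mem_index_iota; split=> //; lia.
Qed.

Lemma partition_nth (s : seq nat) i j :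
  is_partition s -> (i <= j)%N -> (nth 0 s j <= nth 0 s i)%N.
Proof.
move=> s_part ij; have [js|js] := ltnP j (size s); last by rewrite nth_default.
apply: (@sorted_leq_nth _ geq _ _ 0%N s s_part i j) => //.
- by move=> x y z /= xy yz; apply: leq_trans yz xy.
- by move=> x /=.
- exact: leq_ltn_trans ij js.
Qed.

(** Convexity and connectedness are all that the argument below uses about the
    ambient shape. *)
Lemma skew_diagram_convex lam mu :
  is_partition lam -> is_partition mu -> order_convex (skew_diagram lam mu).
Proof.
move=> lamP muP a b x /in_skew_diagramP[i [j [ilam jb ->]]].
move=> /in_skew_diagramP[i' [j' [i'lam j'b ->]]] /= x1 x2.
apply/in_skew_diagramP; exists `|(x.1 - 1)%R|%N, `|x.2|%N.
have lex : (`|(x.1 - 1)%R| <= i')%N by lia.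
have gex : (i <= `|(x.1 - 1)%R|)%N by lia.
have := partition_nth lamP lex; have := partition_nth muP gex.
move=> mu_le lam_le; split; try lia.
by apply: box_ext => /=; lia.
Qed.

Lemma in_translate v (A : {fset box}) x : (x \in translate v A) = (x - v \in A).
Proof.
apply/imfsetP/idP => /= [[y yA ->] | xA]; first by rewrite addrK.
by exists (x - v) => //; rewrite subrK.
Qed.

Lemma skew_shape_convex A : is_skew_shape A -> order_convex A.
Proof.
case=> lam [mu [lamP muP _ [v ->]]] a b x; rewrite !in_translate => aA bA x1 x2.
by apply: (skew_diagram_convex lamP muP aA bA); rewrite !boxE; lia.
Qed.

(** Of two boxes with the same content one lies weakly above and to the left of
    the other; if they differ, convexity fills in a 2x2 block at the former. *)
Lemma border_strip_content_inj S :
  border_strip S -> {in S &, injective content}.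
Proof.
move=> [Sskew _ no_block].
suff wlg (a b : box) : a \in S -> b \in S -> content a = content b -> a.1 <= b.1.
  move=> a b aS bS cab; apply: content_row_inj => //.
  by apply/le_anti; rewrite !wlg.
move=> aS bS cab; rewrite leNgt; apply/negP => ba; apply: no_block; exists b.
have cvx := skew_shape_convex Sskew.
move: cab; rewrite /content => cab.
by rewrite bS /=; apply/and3P; split; apply: (cvx _ _ _ bS aS) => /=; lia.
Qed.

Lemma mem_contents (A : {fset box}) c :
  reflect (exists2 b : box, b \in A & content b = c) (c \in contents A).
Proof. by apply: (iffP (imfsetP _ _ _ _)) => -[b bA eqc]; exists b. Qed.

(** * The contents of a connected set form an interval *)

Definition content_seq (A : {fset box}) : seq int := sort <=%R (contents A).

Lemma size_content_seq A : size (content_seq A) = num_diagonals A.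
Proof. by rewrite size_sort. Qed.

Lemma mem_content_seq A c : (c \in content_seq A) = (c \in contents A).
Proof. by rewrite mem_sort. Qed.

Lemma content_seq_lt A : sorted <%R (content_seq A).
Proof. by rewrite sort_lt_sorted fset_uniq. Qed.

(** A step crossing from the [i]-th content to the next integer exists by
    connectedness, so that integer is a content. *)
Lemma content_seq_consecutive (A : {fset box}) i :
  edgewise_connected A -> (i.+1 < num_diagonals A)%N ->
  nth 0 (content_seq A) i.+1 = nth 0 (content_seq A) i + 1.
Proof.
move=> conn iA; have iA' := ltnW iA.
have /mem_contents[a aA ca]: nth 0 (content_seq A) i \in contents A.
  by rewrite -mem_content_seq mem_nth ?size_content_seq.
have /mem_contents[b bA cb]: nth 0 (content_seq A) i.+1 \in contents A.
  by rewrite -mem_content_seq mem_nth ?size_content_seq.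
have lts := content_seq_lt A.
have ltab : content a < content b.
  by rewrite ca cb; apply: (sortedP 0 lts); rewrite size_content_seq.
have [x [y [_ yA _ _ cy]]] := connected_crossing conn aA bA (lexx _) ltab.
have : content y \in content_seq A.
  by rewrite mem_content_seq; apply/mem_contents; exists y.
case/(nthP 0) => k; rewrite size_content_seq => kA ck.
have mono := @lt_sorted_ltn_nth _ _ 0 _ lts; rewrite size_content_seq in mono.
have ik : (i < k)%N by rewrite -mono ?inE // ck -ca cy; lia.
have [ki|ki] := leqP k i.+1.
  have <- : k = i.+1 by lia.
  by rewrite ck cy ca.
have := mono i.+1 k iA kA; rewrite ki ck -cb; lia.
Qed.

Lemma content_seqE (A : {fset box}) i :
  edgewise_connected A -> (i < num_diagonals A)%N ->
  nth 0 (content_seq A) i = nth 0 (content_seq A) 0 + i%:Z.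
Proof.
move=> conn; elim: i => [|i IH] iA; first by rewrite addr0.
by rewrite content_seq_consecutive // IH 1?ltnW //; lia.
Qed.

(** * Border strips are the right-up walks *)

Lemma strip_boxes_contents S :
  border_strip S -> map content (strip_boxes S) = content_seq S.
Proof.
move=> Sb; have inj := border_strip_content_inj Sb.
have srt : sorted <=%R (map content (strip_boxes S)).
  by rewrite sorted_map; apply: sort_sorted => x y /=; exact: le_total.
apply: (sorted_eq le_trans le_anti srt); first exact: sort_le_sorted.
have pS : perm_eq (strip_boxes S) S by rewrite perm_sort.
apply: uniq_perm; last first.
- move=> c; rewrite mem_content_seq.
  apply/mapP/mem_contents => [[x xS ->]|[x xS <-]]; exists x => //.
  + by rewrite -(perm_mem pS).
  + by rewrite (perm_mem pS).
- by rewrite sort_uniq fset_uniq.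
rewrite map_inj_in_uniq; first by rewrite (perm_uniq pS) fset_uniq.
by move=> x y; rewrite !(perm_mem pS); exact: inj.
Qed.

Lemma mem_strip_boxes S x : (x \in strip_boxes S) = (x \in S).
Proof. by rewrite mem_sort. Qed.

Lemma size_strip_boxes S : size (strip_boxes S) = #|` S|.
Proof. by rewrite size_sort. Qed.

Lemma num_diagonals_strip S : border_strip S -> num_diagonals S = #|` S|.
Proof.
by move=> Sb; rewrite -size_content_seq -strip_boxes_contents // size_map size_strip_boxes.
Qed.

Definition ribbon (s : seq box) : bool := (s != [::]) && sorted step s.

(** The crossing step between two consecutive contents joins the only boxes
    which have these contents. *)
Lemma strip_boxes_ribbon S : border_strip S -> ribbon (strip_boxes S).
Proof.
move=> Sb; have [_ conn _] := Sb; have [S0 _] := conn.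
apply/andP; split.
  by rewrite -size_eq0 size_strip_boxes cardfs_eq0.
apply/(sortedP 0) => i iS; have iS' := ltnW iS.
set a := nth 0 _ i; set b := nth 0 _ i.+1.
have aS : a \in S by rewrite -mem_strip_boxes mem_nth.
have bS : b \in S by rewrite -mem_strip_boxes mem_nth.
have cab : content b = content a + 1.
  rewrite -!(nth_map 0 0 content) // strip_boxes_contents //.
  by rewrite content_seq_consecutive // num_diagonals_strip // -size_strip_boxes.
have [||x [y [xS yS xy cx cy]]] := @connected_crossing S (content a) _ _ conn aS bS.
- exact: lexx.
- lia.
have inj := border_strip_content_inj Sb.
by rewrite -(inj _ _ xS aS cx) -(inj _ _ yS bS) ?cy ?cab.
Qed.

Lemma ribbon_content s i : ribbon s -> (i < size s)%N ->
  content (nth 0 s i) = content (nth 0 s 0) + i%:Z.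
Proof.
move=> /andP[_ /(sortedP 0) st]; elim: i => [|i IH] i_s; first by rewrite addr0.
by rewrite (content_step (st i i_s)) IH 1?ltnW //; lia.
Qed.

Lemma ribbon_content_inj s : ribbon s -> {in s &, injective content}.
Proof.
move=> rs a b /(nthP 0)[i i_s <-] /(nthP 0)[j j_s <-].
by rewrite (ribbon_content rs i_s) (ribbon_content rs j_s) => ij; congr nth; lia.
Qed.

Lemma ribbon_uniq s : ribbon s -> uniq s.
Proof.
move=> rs; apply/(uniqP 0) => i j; rewrite !inE => i_s j_s eq_ij.
have := ribbon_content rs i_s; rewrite eq_ij (ribbon_content rs j_s); lia.
Qed.

Lemma mem_fset_seq (s : seq box) x : (x \in [fset y in s]) = (x \in s).
Proof. by rewrite in_fset. Qed.

(** Contents strictly increase along a walk, so sorting by content recovers the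
    walk. *)
Lemma ribbon_strip_boxes s : ribbon s -> strip_boxes [fset x in s] = s.
Proof.
move=> rs; have inj := ribbon_content_inj rs.
set S := [fset x in s].
have pS : perm_eq (strip_boxes S) s.
  rewrite perm_sort uniq_perm ?fset_uniq ?ribbon_uniq // => x.
  by rewrite mem_fset_seq.
have srt : sorted <=%R (map content (strip_boxes S)).
  by rewrite sorted_map; apply: sort_sorted => x y /=; exact: le_total.
have srt' : sorted <=%R (map content s).
  rewrite sorted_map; case/andP: rs => _; apply: sub_sorted => x y /content_step.
  by rewrite /= => ->; lia.
have := sorted_eq le_trans le_anti srt srt' (perm_map content pS).
move=> eqc; apply: (@eq_from_nth _ 0); first exact: perm_size.
move=> i i_s; have i_s' : (i < size s)%N by rewrite -(perm_size pS).
apply: inj; rewrite -?(perm_mem pS) ?mem_nth //.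
  by rewrite (perm_mem pS) mem_nth.
by rewrite -!(nth_map 0 0 content) // eqc.
Qed.

(** Prepending parts to both partitions adds a top row and pushes the former
    diagram down by one row. *)
Lemma in_skew_diagram_cons l m lam mu (b : box) :
  (b \in skew_diagram (l :: lam) (m :: mu)) =
  ((b.1 == 1) && (m%:Z < b.2 <= l%:Z)) || (b - (1, 0) \in skew_diagram lam mu).
Proof.
apply/in_skew_diagramP/orP => [[[|i] [j [/= ilam jb ->]]] | [/andP[/eqP b1 b2]|]].
- left; move: jb => /=; lia.
- right; apply/in_skew_diagramP; exists i, j; split=> //.
  by apply: box_ext => /=; lia.
- by exists 0%N, `|b.2|%N => /=; split=> //; [lia | apply: box_ext => /=; lia].
- case/in_skew_diagramP => i [j [ilam jb eqb]]; exists i.+1, j; split=> //.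
  by move/(congr1 (fun x => x + (1, 0))): eqb; rewrite subrK => ->; apply: box_ext => /=; lia.
Qed.

Lemma in_skew_diagram_nil b : b \in skew_diagram [::] [::] = false.
Proof. by apply/negP => /in_skew_diagramP[i [j []]]. Qed.

(** The walk is built up towards its last box [x], which is kept at the right
    end of row 1 of the diagram, in column [l].  A step right lengthens row 1; a
    step up adds a new top row consisting of column [l] alone. *)
Lemma rev_ribbon_skew x p : path (fun a b => step b a) x p ->
  exists l m lam mu v,
    [/\ is_partition (l :: lam), is_partition (m :: mu),
        contained (m :: mu) (l :: lam), (m < l)%N & x = (1, l%:Z) + v /\
        translate v (skew_diagram (l :: lam) (m :: mu)) =i x :: p].
Proof.
elim: p x => [|y p IH] x.
  move=> _; exists 1%N, 0%N, [::], [::], (x - (1, 1)); split=> //; split.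
    by rewrite addrC subrK.
  move=> b; rewrite in_translate in_skew_diagram_cons in_skew_diagram_nil orbF inE.
  case: b x => [b1 b2] [x1 x2]; rewrite xpair_eqE /=; lia.
move=> /= /andP[yx /IH[l [m [lam [mu [v [lamP muP cont ml [yE skw]]]]]]]].
case/orP: yx => /eqP xE.
  exists l.+1, m, lam, mu, v; split=> //.
  - move: lamP {muP cont skw yE}; rewrite /is_partition; case: lam => //= a lam /andP[+ ->].
    by rewrite andbT; lia.
  - by move: cont; rewrite /contained /= => /andP[+ ->]; lia.
  - lia.
  - split; first by rewrite xE yE; apply: box_ext => /=; lia.
  move=> b; rewrite inE -skw !in_translate !in_skew_diagram_cons.
  rewrite orbA; congr (_ || _); rewrite xE yE.
  case: b v {yE skw} => [b1 b2] [v1 v2]; rewrite /right_of xpair_eqE /=; lia.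
exists l, l.-1, (l :: lam), (m :: mu), (v - (1, 0)); split=> //.
- by move: lamP; rewrite /is_partition /= => ->; rewrite andbT /=.
- by move: muP; rewrite /is_partition /= => ->; rewrite andbT; lia.
- by move: cont; rewrite /contained /= => ->; lia.
- lia.
- split; first by rewrite xE yE; apply: box_ext => /=; lia.
move=> b; rewrite inE -skw !in_translate [LHS]in_skew_diagram_cons.
have -> : b - (v - (1, 0)) - (1, 0) = b - v by apply: box_ext => /=; lia.
congr (_ || _); rewrite xE yE.
case: b v {yE skw} => [b1 b2] [v1 v2]; rewrite /above xpair_eqE /=; lia.
Qed.

Lemma ribbon_border_strip s : ribbon s -> border_strip [fset x in s].
Proof.
move=> rs; have [s0 st] := andP rs; split.
- have: sorted (fun a b => step b a) (rev s) by rewrite rev_sorted.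
  case E : (rev s) => [|x p].
    by move: s0; rewrite -size_eq0 -size_rev E.
  case/rev_ribbon_skew=> l [m [lam [mu [v [lamP muP cont _ [_ skw]]]]]].
  exists (l :: lam), (m :: mu); split=> //; exists v; apply/fsetP => b.
  by rewrite skw -E mem_rev mem_fset_seq.
- apply/edgewise_connectedP; split.
    apply: contra s0 => /eqP/fsetP s0; case: s {st rs} s0 => // x s /(_ x).
    by rewrite mem_fset_seq !inE eqxx.
  move=> P Pst.
  have P0 i : (i < size s)%N -> P (nth 0 s i) = P (nth 0 s 0).
    elim: i => // i IH i_s; rewrite -IH 1?ltnW //; apply/esym/Pst.
    + by rewrite mem_fset_seq mem_nth // ltnW.
    + by rewrite mem_fset_seq mem_nth.
    + exact: (sortedP 0 st).
  move=> x y; rewrite !mem_fset_seq => /(nthP 0)[i i_s <-] /(nthP 0)[j j_s <-].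
  by rewrite !P0.
- case=> b; rewrite !mem_fset_seq => /and4P[bs _ _ cs].
  have := ribbon_content_inj rs bs cs; rewrite /content /= => /(_ ltac:(lia)).
  by case: (b) => b1 b2 [] /=; lia.
Qed.

Lemma fset_strip_boxes S : [fset x in strip_boxes S] = S.
Proof. by apply/fsetP => x; rewrite mem_fset_seq mem_strip_boxes. Qed.

(** * Directions inside a border strip *)

Lemma ending_box_nth S i : border_strip S -> (i < #|` S|)%N ->
  (strip_box S i == ending_box S) = (i.+1 == #|` S|).
Proof.
move=> Sb iS; have us := ribbon_uniq (strip_boxes_ribbon Sb).
rewrite /strip_box /ending_box -nth_last nth_uniq ?size_strip_boxes //; lia.
Qed.

Lemma next_box_nth S i : border_strip S -> (i < #|` S|)%N ->
  next_box S (strip_box S i) = strip_box S i.+1.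
Proof.
move=> Sb iS; have us := ribbon_uniq (strip_boxes_ribbon Sb).
by rewrite /next_box /strip_box index_uniq ?size_strip_boxes.
Qed.

Lemma strip_box_mem S i : (i < #|` S|)%N -> strip_box S i \in S.
Proof. by move=> iS; rewrite -mem_strip_boxes mem_nth ?size_strip_boxes. Qed.

Lemma strip_goes_right_nth S i : border_strip S -> (i.+1 < #|` S|)%N ->
  strip_goes_right S (strip_box S i) = (strip_box S i.+1 == right_of (strip_box S i)).
Proof.
move=> Sb iS; have iS' := ltnW iS.
by rewrite /strip_goes_right strip_box_mem // ending_box_nth // next_box_nth // ltn_eqF.
Qed.

Lemma strip_goes_up_nth S i : border_strip S -> (i.+1 < #|` S|)%N ->
  strip_goes_up S (strip_box S i) = (strip_box S i.+1 == above (strip_box S i)).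
Proof.
move=> Sb iS; have iS' := ltnW iS.
by rewrite /strip_goes_up strip_box_mem // ending_box_nth // next_box_nth // ltn_eqF.
Qed.

(** Along a walk the content is an affine function of the position. *)
Lemma strip_consecutive S x y : border_strip S -> x \in S -> y \in S ->
  content y = content x + 1 ->
  exists i, [/\ (i.+1 < #|` S|)%N, x = strip_box S i & y = strip_box S i.+1].
Proof.
move=> Sb; rewrite -!mem_strip_boxes -size_strip_boxes /strip_box.
have rs := strip_boxes_ribbon Sb.
move=> /(nthP 0)[i i_s <-] /(nthP 0)[j j_s <-].
rewrite (ribbon_content rs i_s) (ribbon_content rs j_s) => cij.
have eqj : j = i.+1 by lia.
by exists i; rewrite -eqj.
Qed.

Lemma strip_box_step S i : border_strip S -> (i.+1 < #|` S|)%N ->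
  step (strip_box S i) (strip_box S i.+1).
Proof.
rewrite -size_strip_boxes => /strip_boxes_ribbon/andP[_ /(sortedP 0)]; exact.
Qed.

Lemma strip_goes_rightE S b : border_strip S -> b \in S ->
  strip_goes_right S b = (right_of b \in S).
Proof.
move=> Sb bS; apply/idP/idP => [/and3P[_ bend /eqP nb] | rS].
  have /(nthP 0)[i + eqb] : b \in strip_boxes S by rewrite mem_strip_boxes.
  rewrite size_strip_boxes => iS.
  rewrite -/(strip_box S i) in eqb; rewrite -eqb in bend nb *.
  rewrite ending_box_nth // in bend.
  by rewrite -nb next_box_nth // strip_box_mem //; lia.
have [i [iS eqb eqr]] := strip_consecutive Sb bS rS (content_right b).
by rewrite {1}eqb strip_goes_right_nth // -eqb -eqr eqxx.
Qed.

Lemma strip_goes_upE S b : border_strip S -> b \in S ->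
  strip_goes_up S b = (above b \in S).
Proof.
move=> Sb bS; apply/idP/idP => [/and3P[_ bend /eqP nb] | rS].
  have /(nthP 0)[i + eqb] : b \in strip_boxes S by rewrite mem_strip_boxes.
  rewrite size_strip_boxes => iS.
  rewrite -/(strip_box S i) in eqb; rewrite -eqb in bend nb *.
  rewrite ending_box_nth // in bend.
  by rewrite -nb next_box_nth // strip_box_mem //; lia.
have [i [iS eqb eqr]] := strip_consecutive Sb bS rS (content_above b).
by rewrite {1}eqb strip_goes_up_nth // -eqb -eqr eqxx.
Qed.

Lemma ending_boxE S b : border_strip S -> b \in S ->
  (b == ending_box S) = (right_of b \notin S) && (above b \notin S).
Proof.
move=> Sb bS.
have /(nthP 0)[i + eqb] : b \in strip_boxes S by rewrite mem_strip_boxes.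
rewrite size_strip_boxes -/(strip_box S i) in eqb * => iS.
rewrite -{1}eqb ending_box_nth //.
have [eqi | neqi] := eqVneq i.+1 #|` S|; apply/esym.
  apply/andP; split; apply/negP.
    rewrite -strip_goes_rightE // => /and3P[_ + _].
    by rewrite -eqb ending_box_nth // eqi eqxx.
  rewrite -strip_goes_upE // => /and3P[_ + _].
  by rewrite -eqb ending_box_nth // eqi eqxx.
have iS' : (i.+1 < #|` S|)%N by lia.
have := strip_box_step Sb iS'; have := strip_box_mem iS'.
by rewrite eqb => + /orP[] /eqP <- => ->; rewrite ?andbF.
Qed.

Lemma starting_box_neighbours S : border_strip S ->
  [/\ starting_box S \in S, left_of (starting_box S) \notin S
    & below (starting_box S) \notin S].
Proof.
move=> Sb; have rs := strip_boxes_ribbon Sb.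
have cge x : x \in S -> content (starting_box S) <= content x.
  rewrite -mem_strip_boxes => /(nthP 0)[i i_s <-].
  by rewrite (ribbon_content rs i_s) /starting_box -nth0; lia.
split.
- by rewrite -mem_strip_boxes /starting_box -nth0 mem_nth // lt0n size_eq0; case/andP: rs.
- by apply/negP => /cge; rewrite /content /=; lia.
- by apply/negP => /cge; rewrite /content /=; lia.
Qed.

Lemma ending_box_mem S : border_strip S -> ending_box S \in S.
Proof.
move=> Sb; have /andP[s0 _] := strip_boxes_ribbon Sb.
by rewrite -mem_strip_boxes /ending_box -nth_last mem_nth // ltn_predL lt0n size_eq0.
Qed.

(** * Directions in an outside decomposition *)

Definition same_strip (Pi : {fset {fset box}}) (x y : box) : Prop :=
  exists S, [/\ S \in Pi, x \in S & y \in S].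

Lemma decomposition_sub A Pi S : strip_decomposition A Pi -> S \in Pi -> {subset S <= A}.
Proof.
by case=> _ _ <- SPi x xS; apply/bigfcupP; exists S; rewrite ?SPi.
Qed.

Lemma decomposition_cover A Pi b : strip_decomposition A Pi -> b \in A ->
  exists2 S, S \in Pi & b \in S.
Proof. by case=> _ _ <- /bigfcupP[S /andP[SPi _] bS]; exists S. Qed.

Lemma decomposition_uniq A Pi S T b : strip_decomposition A Pi ->
  S \in Pi -> T \in Pi -> b \in S -> b \in T -> S = T.
Proof.
case=> _ /trivIfsetP triv _ SPi TPi bS bT; apply/eqP; apply: contraT => neqST.
by have /fdisjointP/(_ b bS) := triv _ _ SPi TPi neqST; rewrite bT.
Qed.

(** This and the next lemma unfold the two-case definition of directions into
    membership of neighbours, so that no reference to ending boxes is left. *)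
Lemma goes_upE A Pi S b : strip_decomposition A Pi -> S \in Pi -> b \in S ->
  goes_up A Pi b <-> above b \in S \/ (right_of b \notin S) && (above b \notin A).
Proof.
move=> dec SPi bS; have [strips _ _] := dec; have Sb := strips _ SPi.
have subA := decomposition_sub dec SPi.
have bA := subA _ bS.
have -> : goes_up A Pi b <->
    if b == ending_box S then on_top_perimeter A b else strip_goes_up S b.
  split=> [[T [TPi bT]]|]; last by exists S.
  by rewrite (decomposition_uniq dec TPi SPi bT bS).
rewrite ending_boxE // strip_goes_upE // /on_top_perimeter bA /=.
case: (boolP (above b \in S)) => [aS|]; first by rewrite andbF; split; [left|].
case: (boolP (right_of b \in S)) => //= rS aS; first by split=> // -[].
by split=> [|[]] //; right.
Qed.

Lemma goes_rightE A Pi S b : strip_decomposition A Pi -> S \in Pi -> b \in S ->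
  goes_right A Pi b <->
  right_of b \in S \/ [&& above b \notin S, right_of b \notin A & above b \in A].
Proof.
move=> dec SPi bS; have [strips _ _] := dec; have Sb := strips _ SPi.
have subA := decomposition_sub dec SPi.
have bA := subA _ bS.
have -> : goes_right A Pi b <->
    if b == ending_box S then on_right_perimeter A b && ~~ on_top_perimeter A b
    else strip_goes_right S b.
  split=> [[T [TPi bT]]|]; last by exists S.
  by rewrite (decomposition_uniq dec TPi SPi bT bS).
rewrite ending_boxE // strip_goes_rightE // /on_top_perimeter /on_right_perimeter.
rewrite bA /= negbK.
case: (boolP (right_of b \in S)) => [rS|]; first by split; [left|].
case: (boolP (above b \in S)) => //= rS aS; first by split=> // -[].
by split=> [|[]] //; right.
Qed.

Lemma strip_not_both S b : border_strip S -> b \in S ->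
  ~~ ((right_of b \in S) && (above b \in S)).
Proof.
move=> Sb bS; apply/negP => /andP[rS aS].
have /eqP := right_neq_above b; apply; apply: (border_strip_content_inj Sb) => //.
by rewrite content_right content_above.
Qed.

(** Every box has a direction because an ending box lies on the right or on the
    top perimeter. *)
Lemma goes_right_not_up A Pi b : outside_decomposition A Pi -> b \in A ->
  goes_right A Pi b <-> ~ goes_up A Pi b.
Proof.
move=> [dec out] bA; have [S SPi bS] := decomposition_cover dec bA.
have [strips _ _] := dec; have Sb := strips _ SPi.
have both := strip_not_both Sb bS.
have outb : right_of b \notin S -> above b \notin S ->
    (right_of b \notin A) || (above b \notin A).
  move=> rS aS; have [_] := out _ SPi.
  have /eqP <- : b == ending_box S by rewrite ending_boxE // rS aS.
  by rewrite /on_right_perimeter /on_top_perimeter bA.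
have subA := decomposition_sub dec SPi.
rewrite (goes_upE dec SPi bS) (goes_rightE dec SPi bS).
have raA := contra (subA (right_of b)).
have aaA := contra (subA (above b)).
move: both outb raA aaA.
case: (right_of b \in S); case: (above b \in S);
  case: (right_of b \in A); case: (above b \in A) => //=; intuition.
Qed.

Lemma same_strip_right A Pi b : outside_decomposition A Pi -> b \in A ->
  same_strip Pi b (right_of b) <-> right_of b \in A /\ goes_right A Pi b.
Proof.
move=> [dec _] bA; have [S SPi bS] := decomposition_cover dec bA.
rewrite (goes_rightE dec SPi bS); split=> [[T [TPi bT rT]] | [rA]].
  split; first exact: decomposition_sub dec TPi _ rT.
  by left; rewrite (decomposition_uniq dec SPi TPi bS bT).
by case=> [rS | /and3P[_ +]]; [exists S | rewrite rA].
Qed.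

Lemma same_strip_above A Pi b : outside_decomposition A Pi -> b \in A ->
  same_strip Pi b (above b) <-> above b \in A /\ goes_up A Pi b.
Proof.
move=> [dec _] bA; have [S SPi bS] := decomposition_cover dec bA.
rewrite (goes_upE dec SPi bS); split=> [[T [TPi bT rT]] | [rA]].
  split; first exact: decomposition_sub dec TPi _ rT.
  by left; rewrite (decomposition_uniq dec SPi TPi bS bT).
by case=> [rS | /andP[_]]; [exists S | rewrite rA].
Qed.

(** The nested property for neighbours on a diagonal: the box to the right of
    [b], which is above [b + (1, 1)], is not a starting box, hence is entered
    from exactly one of these two boxes. *)
Lemma goes_up_next_on_diagonal A Pi b :
  outside_decomposition A Pi -> order_convex A ->
  b \in A -> b + (1, 1) \in A ->
  goes_up A Pi b <-> goes_up A Pi (b + (1, 1)).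
Proof.
move=> out cvx bA b'A; have [dec outS] := out; have [strips _ _] := dec.
set b' := b + (1, 1) in b'A *; set c := right_of b.
have cE : above b' = c by apply: box_ext => /=; lia.
have cA : c \in A by apply: (cvx _ _ _ bA b'A); rewrite /b' /= ?boxE /=; lia.
have [S SPi cS] := decomposition_cover dec cA.
have Sb := strips _ SPi.
have Sb' : (b' \in S) <-> goes_up A Pi b'.
  have := same_strip_above out b'A; rewrite cE => -[h1 h2].
  split=> [b'S | up].
    by case: h1 => //; exists S.
  have [T [TPi b'T cT]] := h2 (conj cA up).
  by rewrite (decomposition_uniq dec SPi TPi cS cT).
have Sbr : (b \in S) <-> goes_right A Pi b.
  have := same_strip_right out bA; rewrite -/c => -[h1 h2].
  split=> [bS | rt].
    by case: h1 => //; exists S.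
  have [T [TPi bT cT]] := h2 (conj cA rt).
  by rewrite (decomposition_uniq dec SPi TPi cS cT).
have cbb' : content b = content b' by rewrite /content /b' !boxE /=; lia.
have neqb : b <> b' by move=> /(congr1 fst); rewrite /b' boxE /=; lia.
have nrup := goes_right_not_up out bA.
(* [c] has both neighbours in [A], so the strip [S] enters it from one of them. *)
have one : b \in S \/ b' \in S.
  apply: contrapT => /not_orP[/negP bS /negP b'S].
  have [st _] := outS _ SPi.
  suff /eqP Ec : c == starting_box S.
    move: st; rewrite -Ec /on_left_perimeter /on_bottom_perimeter.
    have -> : left_of c = b by apply: box_ext => /=; lia.
    have -> : below c = b' by rewrite -cE; apply: box_ext => /=; lia.
    by rewrite bA b'A !andbF.
  have [i i_s Ei] : exists2 i, (i < size (strip_boxes S))%N & nth 0 (strip_boxes S) i = c.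
    by apply/nthP; rewrite mem_strip_boxes.
  case: i => [|i] in i_s Ei; first by rewrite /starting_box -nth0 Ei.
  rewrite size_strip_boxes in i_s.
  have := strip_box_step Sb i_s; rewrite /strip_box Ei -/(strip_box S i).
  have iS := strip_box_mem (ltnW i_s).
  case/orP => /eqP Ec.
    by move/right_of_inj: Ec iS => <-; rewrite (negPf bS).
  by move: Ec iS; rewrite -cE => /above_inj <-; rewrite (negPf b'S).
(* A strip has at most one box of each content. *)
have two : ~ (b \in S /\ b' \in S).
  by case=> bS b'S; apply: neqb; apply: (border_strip_content_inj Sb).
by have [up|not_up] := EM (goes_up A Pi b); tauto.
Qed.

Lemma goes_up_diagonal A Pi (a b : box) :
  outside_decomposition A Pi -> order_convex A ->
  a \in A -> b \in A -> content a = content b ->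
  goes_up A Pi a <-> goes_up A Pi b.
Proof.
move=> out cvx.
(* Convexity puts the intermediate boxes of the diagonal in [A]. *)
have shift (n : nat) : forall a : box, a \in A -> a + (n%:Z, n%:Z) \in A ->
    goes_up A Pi a <-> goes_up A Pi (a + (n%:Z, n%:Z)).
  elim: n => [|n IH] {}a aA nA; first by rewrite addr0.
  have a1A : a + (1, 1) \in A by apply: (cvx _ _ _ aA nA); rewrite !boxE /=; lia.
  rewrite (goes_up_next_on_diagonal out cvx aA a1A).
  have En : a + (n.+1%:Z, n.+1%:Z) = a + (1, 1) + (n%:Z, n%:Z).
    by apply: box_ext; rewrite !boxE /=; lia.
  by rewrite En in nA *; exact: IH.
have shiftE (c d : box) : content c = content d -> c.1 <= d.1 ->
    d = c + ((`|(d.1 - c.1)%R|%N)%:Z, (`|(d.1 - c.1)%R|%N)%:Z).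
  by rewrite /content => cd le1; apply: box_ext; rewrite boxE /=; lia.
move=> aA bA cab; have [ab|/ltW ba] := leP a.1 b.1.
  by rewrite (shiftE a b cab ab); apply: shift; rewrite -?shiftE.
by apply: iff_sym; rewrite (shiftE b a (esym cab) ba); apply: shift; rewrite -?shiftE.
Qed.

(** * Walks with prescribed turns *)

Definition turn (up : bool) (b : box) : box := if up then above b else right_of b.

Lemma content_turn u b : content (turn u b) = content b + 1.
Proof. by case: u; rewrite /= ?content_above ?content_right. Qed.

Lemma turnD u b v : turn u (b + v) = turn u b + v.
Proof. by apply: box_ext; case: u; rewrite /= ?boxE /= ?boxE //; lia. Qed.

Lemma step_turn u b : step b (turn u b).
Proof. by rewrite /step; case: u; rewrite /= eqxx ?orbT. Qed.

(** The turn is a function of the content, which is what makes [successor] a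
    bijection of the plane. *)
Definition successor (U : int -> bool) (b : box) : box := turn (U (content b)) b.

Definition predecessor (U : int -> bool) (b : box) : box :=
  if U (content b - 1) then below b else left_of b.

Lemma content_successor U b : content (successor U b) = content b + 1.
Proof. exact: content_turn. Qed.

Lemma successorK U : cancel (successor U) (predecessor U).
Proof.
move=> b; rewrite /predecessor content_successor addrK /successor.
by case: (U _); rewrite ?aboveK ?right_ofK.
Qed.

Lemma predecessorK U : cancel (predecessor U) (successor U).
Proof.
move=> b; rewrite /predecessor /successor.
case Uc: (U (content b - 1)).
  have -> : content (below b) = content b - 1.
    by rewrite -[in RHS](belowK b) content_above addrK.
  by rewrite Uc /= belowK.
have -> : content (left_of b) = content b - 1.
  by rewrite -[in RHS](left_ofK b) content_right addrK.
by rewrite Uc /= left_ofK.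
Qed.

Lemma content_predecessor U b : content (predecessor U b) = content b - 1.
Proof. by rewrite -[in RHS](predecessorK U b) content_successor addrK. Qed.

Lemma traject_ribbon U b n : ribbon (traject (successor U) b n.+1).
Proof.
rewrite /ribbon /=; elim: n b => //= n IH b.
by rewrite step_turn IH.
Qed.

Lemma content_iter_successor U b k :
  content (iter k (successor U) b) = content b + k%:Z.
Proof. by elim: k => [|k IH]; rewrite ?addr0 //= content_successor IH; lia. Qed.

(** * The cutting strip *)

(** The boxes of [A] that do not lie on its last diagonal. *)
Definition inner (A : {fset box}) (b : box) : bool :=
  (b \in A) && (content b + 1 \in contents A).

(** Only inner boxes are constrained: on the last diagonal the cutting strip
    makes no turn. *)
Definition directed (A : {fset box}) (Pi : {fset {fset box}})
    (U : int -> bool) : Prop :=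
  forall b, inner A b -> goes_up A Pi b <-> U (content b).

Lemma directed_exists A Pi : outside_decomposition A Pi -> order_convex A ->
  exists U, directed A Pi U.
Proof.
move=> out cvx.
exists (fun c => `[< exists2 b, b \in A & content b = c /\ goes_up A Pi b >]).
move=> b /andP[bA _]; split=> [up | /asboolP[a aA [cab up]]].
  by apply/asboolP; exists b.
by rewrite -(goes_up_diagonal out cvx aA bA cab).
Qed.

Definition min_content (A : {fset box}) : int := nth 0 (content_seq A) 0.

Lemma mem_diagonal A i b : (b \in Defs.diagonal A i) =
  (b \in A) && (content b == nth 0 (content_seq A) i).
Proof. by rewrite /Defs.diagonal !inE. Qed.

Lemma contentsE A c : edgewise_connected A ->
  (c \in contents A) = (min_content A <= c < min_content A + (num_diagonals A)%:Z).
Proof.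
move=> conn; rewrite -mem_content_seq; apply/(nthP 0)/idP => [[i] | cA].
  by rewrite size_content_seq => iA <-; rewrite content_seqE // /min_content; lia.
exists `|c - min_content A|%N; first by rewrite size_content_seq; lia.
by rewrite content_seqE // -?/(min_content A); lia.
Qed.

Lemma inner_contentP A b : edgewise_connected A -> inner A b ->
  exists2 i, (i.+1 < num_diagonals A)%N & content b = min_content A + i%:Z.
Proof.
move=> conn /andP[bA c1].
have : content b \in contents A by apply/mem_contents; exists b.
move: c1; rewrite !contentsE // => c1 c0.
by exists `|content b - min_content A|%N; lia.
Qed.

Lemma diagonal_innerP A i : edgewise_connected A -> (i.+1 < num_diagonals A)%N ->
  (exists b, b \in Defs.diagonal A i) /\
  forall b, b \in Defs.diagonal A i -> inner A b /\ content b = min_content A + i%:Z.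
Proof.
move=> conn iA; have iA' := ltnW iA; split.
  have : nth 0 (content_seq A) i \in contents A.
    by rewrite content_seqE // contentsE // /min_content; lia.
  by case/mem_contents=> b bA cb; exists b; rewrite mem_diagonal bA cb eqxx.
move=> b; rewrite mem_diagonal content_seqE // => /andP[bA /eqP cb].
by rewrite /inner bA contentsE // cb /min_content; split=> //; lia.
Qed.

Lemma cutting_stripP A Pi U S :
  edgewise_connected A -> outside_decomposition A Pi -> directed A Pi U ->
  cutting_strip A Pi S <->
  [/\ border_strip S, #|` S| = num_diagonals A
    & forall i, (i.+1 < num_diagonals A)%N ->
      strip_box S i.+1 = turn (U (min_content A + i%:Z)) (strip_box S i)].
Proof.
move=> conn out dirU; split=> -[Sb cardS dirS]; split=> // i iA.
  have [[b bi] /(_ b bi)[innb cb]] := diagonal_innerP conn iA.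
  have bA : b \in A by case/andP: innb.
  have [right_iff up_iff] := dirS i iA b bi.
  rewrite -cb.
  rewrite strip_goes_right_nth ?cardS // in right_iff.
  rewrite strip_goes_up_nth ?cardS // in up_iff.
  have dirb := dirU b innb.
  have rtb := goes_right_not_up out bA.
  case Uc: (U (content b)); rewrite Uc in dirb; apply/eqP => /=.
    by apply/up_iff/dirb.
  by apply/right_iff/rtb => /dirb.
move=> b bi; have [_ /(_ b bi)[innb cb]] := diagonal_innerP conn iA.
have bA : b \in A by case/andP: innb.
rewrite strip_goes_right_nth ?cardS // strip_goes_up_nth ?cardS //.
rewrite goes_right_not_up // dirU // dirS // cb.
have neq := negPf (right_neq_above (strip_box S i)).
by case: (U _); rewrite /= eqxx ?neq 1?eq_sym ?neq; split; split.
Qed.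

Lemma strip_boxes_translate S v : border_strip S ->
  border_strip (translate v S) /\
  strip_boxes (translate v S) = map (fun b => b + v) (strip_boxes S).
Proof.
move=> Sb; have /andP[s0 st] := strip_boxes_ribbon Sb.
have rib : ribbon (map (fun b => b + v) (strip_boxes S)).
  rewrite /ribbon sorted_map -size_eq0 size_map size_eq0 s0 /=.
  apply: sub_sorted st => x y /orP[] /eqP -> /=.
    by rewrite -(turnD false) (step_turn false).
  by rewrite -(turnD true) (step_turn true).
have <- : [fset x in map (fun b => b + v) (strip_boxes S)] = translate v S.
  apply/fsetP => x; rewrite mem_fset_seq in_translate -mem_strip_boxes.
  by rewrite -[in LHS](subrK v x) (mem_map (addIr v)).
by split; [exact: ribbon_border_strip | exact: ribbon_strip_boxes].
Qed.

Lemma card_translate v (S : {fset box}) : #|` translate v S| = #|` S|.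
Proof. by rewrite card_imfset //; exact: addIr. Qed.

Lemma strip_box_translate S v i : border_strip S -> (i < #|` S|)%N ->
  strip_box (translate v S) i = strip_box S i + v.
Proof.
move=> Sb iS; have [_ eqs] := strip_boxes_translate v Sb.
by rewrite /strip_box eqs (nth_map 0) // size_strip_boxes.
Qed.

(** Two walks with the same turns differ by the translation that matches their
    first boxes. *)
Lemma cutting_strip_translation_class A Pi S :
  edgewise_connected A -> order_convex A -> outside_decomposition A Pi ->
  cutting_strip A Pi S -> cutting_strip A Pi = translation_class S.
Proof.
move=> conn cvx out; have [U dirU] := directed_exists out cvx.
have cutP := cutting_stripP _ conn out dirU.
move=> /cutP[Sb cardS dirS]; apply/seteqP; split=> B.
  move=> /cutP[Bb cardB dirB]; exists (strip_box B 0 - strip_box S 0).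
  set v := _ - _.
  have eqBS i : (i < num_diagonals A)%N -> strip_box B i = strip_box S i + v.
    elim: i => [|i IH] iA; first by rewrite /v addrC subrK.
    by rewrite dirB // dirS // IH ?turnD // ltnW.
  have [_ eqs] := strip_boxes_translate v Sb.
  rewrite -[LHS]fset_strip_boxes -[RHS]fset_strip_boxes.
  suff -> : strip_boxes B = strip_boxes (translate v S) by [].
  apply: (@eq_from_nth _ 0); rewrite !size_strip_boxes ?card_translate ?cardB //.
  by move=> i iA; rewrite -!/(strip_box _ i) strip_box_translate ?cardS ?eqBS.
case=> v ->; apply/cutP; have [Tb eqs] := strip_boxes_translate v Sb.
split=> //; first by rewrite card_translate.
move=> i iA; rewrite !strip_box_translate ?cardS //; last exact: ltnW.
by rewrite dirS // turnD.
Qed.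

Lemma cutting_strip_exists A Pi :
  edgewise_connected A -> order_convex A -> outside_decomposition A Pi ->
  exists S, cutting_strip A Pi S.
Proof.
move=> conn cvx out; have [U dirU] := directed_exists out cvx.
have d0 : (0 < num_diagonals A)%N.
  have [/fset0Pn[b bA] _] := conn.
  rewrite /num_diagonals cardfs_gt0; apply/fset0Pn; exists (content b).
  by apply/mem_contents; exists b.
have /mem_contents[b bA cb] : min_content A \in contents A by rewrite contentsE //; lia.
case Ed : (num_diagonals A) d0 => [//|n] _.
have rib := traject_ribbon U b n.
exists [fset x in traject (successor U) b n.+1]; apply/(cutting_stripP _ conn out dirU).
split; first exact: ribbon_border_strip.
  by rewrite -size_strip_boxes ribbon_strip_boxes // size_traject.
move=> i; rewrite Ed => iA; rewrite /strip_box ribbon_strip_boxes //.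
have iA' := ltnW iA; rewrite !(set_nth_default b 0) ?size_traject //.
by rewrite !nth_traject // iterS -cb -(content_iter_successor U).
Qed.

(** * Injectivity *)

Definition refines (Pi Pi' : {fset {fset box}}) :=
  forall x y, step x y -> same_strip Pi x y -> same_strip Pi' x y.

(** A strip is connected by steps, and none of its steps leaves [T]. *)
Lemma decomposition_strips_sub A Pi Pi' :
  strip_decomposition A Pi -> strip_decomposition A Pi' -> refines Pi Pi' ->
  forall S T b, S \in Pi -> T \in Pi' -> b \in S -> b \in T -> {subset S <= T}.
Proof.
move=> dec dec' ref S T b SPi TPi bS bT x xS.
have [strips _ _] := dec; have [_ /edgewise_connectedP[_ conn] _] := strips _ SPi.
rewrite (conn (fun y => y \in T) _ x b xS bS) // => y z yS zS yz.
have [V [VPi yV zV]] : same_strip Pi' y z by apply: ref => //; exists S.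
apply/idP/idP => inT; first by rewrite (decomposition_uniq dec' TPi VPi inT yV).
by rewrite (decomposition_uniq dec' TPi VPi inT zV).
Qed.

Lemma decomposition_sub_of_refines A Pi Pi' :
  strip_decomposition A Pi -> strip_decomposition A Pi' ->
  refines Pi Pi' -> refines Pi' Pi -> {subset Pi <= Pi'}.
Proof.
move=> dec dec' ref ref' S SPi; have [strips _ _] := dec.
have [_ [/fset0Pn[b bS] _] _] := strips _ SPi.
have [T TPi bT] := decomposition_cover dec' (decomposition_sub dec SPi bS).
suff -> : S = T by [].
apply/fsetP => x; apply/idP/idP.
  exact: (decomposition_strips_sub dec dec' ref SPi TPi bS bT).
exact: (decomposition_strips_sub dec' dec ref' TPi SPi bT bS).
Qed.

(** A box that is followed by another box of its strip is inner, so its turn can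
    be read off the common cutting strip [S]. *)
Lemma cutting_strip_refines A Pi Pi' S :
  edgewise_connected A -> order_convex A ->
  outside_decomposition A Pi -> outside_decomposition A Pi' ->
  cutting_strip A Pi S -> cutting_strip A Pi' S -> refines Pi Pi'.
Proof.
move=> conn cvx out out'.
have [U dirU] := directed_exists out cvx; have [U' dirU'] := directed_exists out' cvx.
move=> /(cutting_stripP _ conn out dirU)[_ _ dirS].
move=> /(cutting_stripP _ conn out' dirU')[_ _ dirS'] x y xy same.
have [T [TPi xT yT]] := same.
have [dec _] := out.
have xA := decomposition_sub dec TPi xT; have yA := decomposition_sub dec TPi yT.
have innx : inner A x.
  by rewrite /inner xA -(content_step xy); apply/mem_contents; exists y.
have UU' : U (content x) = U' (content x).
  have [i iA ->] := inner_contentP conn innx.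
  have := dirS i iA; rewrite dirS' //.
  case: (U _); case: (U' _) => //= /eqP; rewrite 1?eq_sym ?(negPf (right_neq_above _)) //.
  by rewrite eq_sym (negPf (right_neq_above _)).
have upE : goes_up A Pi x <-> goes_up A Pi' x by rewrite dirU // dirU' // UU'.
case/orP: xy same yA => /eqP -> same yA.
  have [_] := (same_strip_right out xA).1 same.
  rewrite (goes_right_not_up out xA) upE -(goes_right_not_up out' xA) => rt.
  by apply/(same_strip_right out' xA).
have [_] := (same_strip_above out xA).1 same; rewrite upE => up.
by apply/(same_strip_above out' xA).
Qed.

Lemma cutting_strip_inj A Pi Pi' :
  edgewise_connected A -> order_convex A ->
  outside_decomposition A Pi -> outside_decomposition A Pi' ->
  cutting_strip A Pi = cutting_strip A Pi' -> Pi = Pi'.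
Proof.
move=> conn cvx out out' eqc.
have [S cutS] := cutting_strip_exists conn cvx out.
have cutS' : cutting_strip A Pi' S by rewrite -eqc.
have ref := cutting_strip_refines conn cvx out out' cutS cutS'.
have ref' := cutting_strip_refines conn cvx out' out cutS' cutS.
have [[dec _] [dec' _]] := (out, out').
apply/fsetP => T; apply/idP/idP.
  exact: (decomposition_sub_of_refines dec dec' ref ref').
exact: (decomposition_sub_of_refines dec' dec ref' ref).
Qed.

Lemma leaves_fset (A : {fset box}) (f : box -> box) b :
  injective (fun k => iter k f b) ->
  exists2 n, iter n f b \notin A & forall k, (k < n)%N -> iter k f b \in A.
Proof.
move=> inj.
have ex : exists n, iter n f b \notin A.
  apply: contrapT => /forallNP stay.
  have sub : {subset traject f b #|` A|.+1 <= A}.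
    by move=> x /trajectP[k _ ->]; apply/negPn/negP; exact: stay.
  have us : uniq (traject f b #|` A|.+1).
    apply/(uniqP b) => i j; rewrite !inE size_traject => iA jA.
    by rewrite !nth_traject // => /inj.
  by have := uniq_leq_size us sub; rewrite size_traject ltnn.
have [n nA nmin] := ex_minnP ex.
exists n => // k kn; apply/negPn/negP => /nmin; lia.
Qed.


(** * Surjectivity *)

Definition exit_time (A : {fset box}) (f : box -> box) (b : box) (n : nat) : Prop :=
  iter n f b \notin A /\ forall k, (k < n)%N -> iter k f b \in A.

(** The successor orbits cut at the boundary of [A], indexed by their first
    boxes, when [len b] is the exit time of the orbit that starts at [b]. *)
Definition maximal_chains (A : {fset box}) (U : int -> bool) (len : box -> nat) :
    {fset {fset box}} :=
  [fset [fset x in traject (successor U) b (len b)]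
    | b in [fset b in A | predecessor U b \notin A]].

(** What makes maximal chains disjoint and puts their ends on the perimeter: they
    are closed under successors and predecessors within [A]. *)
Definition chain_closed (A S : {fset box}) (U : int -> bool) : Prop :=
  [/\ border_strip S, {subset S <= A},
      {in S &, forall x y, step x y -> y = successor U x},
      {in S, forall x, successor U x \in A -> successor U x \in S}
    & {in S, forall x, predecessor U x \in A -> predecessor U x \in S}].

Lemma maximal_chain_closed A U len S :
  (forall b, exit_time A (successor U) b (len b)) ->
  S \in maximal_chains A U len -> chain_closed A S U.
Proof.
move=> lenP /imfsetP[b /=]; rewrite !inE => /andP[bA predb] ->.
have [out inn] := lenP b.
set n := len b in out inn *; set S0 := [fset x in _].
have memS x : reflect (exists2 k, (k < n)%N & x = iter k (successor U) b) (x \in S0).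
  by rewrite mem_fset_seq; exact: trajectP.
have n0 : n = n.-1.+1 by case: n out {inn S0 memS} => //=; rewrite bA.
split.
- by apply: ribbon_border_strip; rewrite n0; exact: traject_ribbon.
- by move=> _ /memS[k kn ->]; exact: inn.
- move=> _ _ /memS[k kn ->] /memS[l ln ->] /content_step.
  rewrite !content_iter_successor -iterS => ckl.
  by have -> : l = k.+1 by lia.
- move=> _ /memS[k kn ->]; rewrite -iterS => kA; apply/memS; exists k.+1 => //.
  by rewrite ltn_neqAle kn andbT; apply: contraNneq out => <-.
- move=> _ /memS[[|k] kn ->]; first by rewrite (negPf predb).
  by rewrite iterS successorK => _; apply/memS; exists k => //; exact: ltnW.
Qed.

Lemma chain_closed_sub A U S T b :
  chain_closed A S U -> chain_closed A T U -> b \in S -> b \in T ->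
  {subset S <= T}.
Proof.
move=> [[_ /edgewise_connectedP[_ conn] _] SA stepS _ _] [_ _ _ sucT preT] bS bT x xS.
rewrite (conn (fun y => y \in T) _ x b xS bS) // => y z yS zS yz.
have zE := stepS y z yS zS yz; apply/idP/idP => [yT | zT].
  by rewrite zE sucT // -zE SA.
have yE : y = predecessor U z by rewrite zE successorK.
by rewrite yE preT // -yE SA.
Qed.

Lemma iter_inj_content (f : box -> box) (e : int) b :
  e != 0 -> (forall x, content (f x) = content x + e) ->
  injective (fun k => iter k f b).
Proof.
move=> e0 cf.
have citer k : content (iter k f b) = content b + e * k%:Z.
  by elim: k => [|k IH]; rewrite ?mulr0 ?addr0 //= cf IH; lia.
move=> i j /= /(congr1 content); rewrite !citer => /addrI /(mulfI e0); lia.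
Qed.

(** The chain through [x] starts at the last box in [A] reached from [x] by
    predecessors.  The missing successor of an ending box, or predecessor of a
    starting box, is the neighbour that puts it on the perimeter. *)
Lemma maximal_chains_outside A U len :
  (forall b, exit_time A (successor U) b (len b)) ->
  outside_decomposition A (maximal_chains A U len).
Proof.
move=> lenP; have closed := maximal_chain_closed lenP; split; first split.
- by move=> S /closed[].
- apply/trivIfsetP => S T SPi TPi; apply: contraR => /fdisjointP meet.
  have [b bS bT] : exists2 b, b \in S & b \in T.
    apply: contrapT => none; apply: meet => b bS.
    by apply/negP => bT; apply: none; exists b.
  apply/eqP/fsetP => x; apply/idP/idP.
    exact: (chain_closed_sub (closed _ SPi) (closed _ TPi) bS bT).
  exact: (chain_closed_sub (closed _ TPi) (closed _ SPi) bT bS).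
- apply/fsetP => x; apply/bigfcupP/idP => [[S /andP[SPi _] xS] | xA].
    by have [_ SA _ _ _] := closed _ SPi; exact: SA.
  have pinj : injective (fun k => iter k (predecessor U) x).
    by apply: (@iter_inj_content _ (-1)) => // y; exact: content_predecessor.
  have [[|n] out inn] := leaves_fset A pinj; first by rewrite /= xA in out.
  set b := iter n (predecessor U) x.
  have xE k : (k <= n)%N -> iter k (successor U) b = iter (n - k) (predecessor U) x.
    elim: k => [|k IH] kn; first by rewrite subn0.
    rewrite iterS IH 1?ltnW //.
    have -> : (n - k)%N = (n - k.+1).+1 by lia.
    by rewrite iterS predecessorK.
  have [outb _] := lenP b.
  exists [fset y in traject (successor U) b (len b)]; last first.
    rewrite mem_fset_seq; apply/trajectP; exists n; last by rewrite xE // subnn.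
    rewrite ltnNge; apply/negP => lenn.
    by move: outb; rewrite xE // inn //; lia.
  rewrite andbT; apply/imfsetP; exists b => //=.
  by rewrite !inE inn //=.
- move=> S SPi; have [Sb SA _ sucS preS] := closed _ SPi.
  have [stS lefS belS] := starting_box_neighbours Sb.
  have enS := ending_box_mem Sb; split.
    rewrite /on_left_perimeter /on_bottom_perimeter (SA _ stS) /=.
    have := preS _ stS; rewrite /predecessor; case: ifP => _ preA.
      by apply/orP; right; apply: contra belS.
    by apply/orP; left; apply: contra lefS.
  rewrite /on_right_perimeter /on_top_perimeter (SA _ enS) /=.
  have := ending_boxE Sb enS; rewrite eqxx => /esym/andP[rS aS].
  have := sucS _ enS; rewrite /successor; case: (U _) => /= sucA.
    by apply/orP; right; apply: contra aS.
  by apply/orP; left; apply: contra rS.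
Qed.

(** By convexity a box with neither neighbour is alone on its diagonal, so no
    step can leave that diagonal towards larger contents. *)
Lemma inner_not_corner A b :
  edgewise_connected A -> order_convex A -> inner A b ->
  (right_of b \in A) || (above b \in A).
Proof.
move=> conn cvx /andP[bA /mem_contents[c cA cc]].
have [||x [y [xA yA xy cx _]]] := @connected_crossing A (content b) _ _ conn bA cA.
- exact: lexx.
- lia.
have [lt|gt|eqx] := ltgtP x.1 b.1.
- apply/orP; right; move: cx; rewrite /content => cx.
  by apply: (cvx _ _ _ xA bA) => /=; lia.
- apply/orP; left; move: cx; rewrite /content => cx.
  by apply: (cvx _ _ _ bA xA) => /=; lia.
- by rewrite -(content_row_inj cx eqx); case/orP: xy yA => /eqP -> ->; rewrite ?orbT.
Qed.

Lemma maximal_chains_directed A U len :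
  edgewise_connected A -> order_convex A ->
  (forall b, exit_time A (successor U) b (len b)) ->
  directed A (maximal_chains A U len) U.
Proof.
move=> conn cvx lenP b innb; have [bA _] := andP innb.
have out := maximal_chains_outside lenP; have [dec _] := out.
have [S SPi bS] := decomposition_cover dec bA.
have [Sb SA stepS sucS _] := maximal_chain_closed lenP SPi.
have := sucS _ bS; rewrite /successor.
have stepr : right_of b \in S -> right_of b = turn (U (content b)) b.
  by move=> rS; apply: stepS => //; rewrite /step eqxx.
have stepa : above b \in S -> above b = turn (U (content b)) b.
  by move=> aS; apply: stepS => //; rewrite /step eqxx orbT.
have neq := right_neq_above b.
case: (U _) stepr stepa => /= stepr stepa sucA.
  split=> // _; apply/(goes_upE dec SPi bS).
  have rS : right_of b \notin S by apply: contra neq => /stepr ->.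
  by rewrite rS; have [/sucA|] := boolP (above b \in A); [left | right].
split=> // up; suff : goes_right A (maximal_chains A U len) b.
  by rewrite goes_right_not_up.
apply/(goes_rightE dec SPi bS).
have aS : above b \notin S by apply: contra neq => /stepa ->.
have := inner_not_corner conn cvx innb.
rewrite aS; have [/sucA|rA] := boolP (right_of b \in A); first by left.
by move=> aA; right.
Qed.

(** The turn prescribed at content [c] is the one made by [S] after as many
    steps as [c] exceeds the least content of [A]. *)
Lemma cutting_strip_surj A S :
  edgewise_connected A -> order_convex A ->
  border_strip S -> #|` S| = num_diagonals A ->
  exists2 Pi, outside_decomposition A Pi & cutting_strip A Pi S.
Proof.
move=> conn cvx Sb cardS.
pose U c := strip_goes_up S (strip_box S `|(c - min_content A)%R|%N).
have exits b : exists n, exit_time A (successor U) b n.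
  have sinj : injective (fun k => iter k (successor U) b).
    by apply: (@iter_inj_content _ 1) => // y; exact: content_successor.
  by have [n nA kA] := leaves_fset A sinj; exists n.
have [len lenP] := choice exits.
have out := maximal_chains_outside lenP.
exists (maximal_chains A U len) => //.
apply/(cutting_stripP _ conn out (maximal_chains_directed conn cvx lenP)).
split=> // i iA; rewrite /U.
have -> : `|(min_content A + i%:Z - min_content A)%R|%N = i by lia.
rewrite strip_goes_up_nth ?cardS //.
have := strip_box_step Sb; rewrite cardS => /(_ i iA).
by case/orP=> /eqP ->; rewrite ?eqxx ?(negPf (right_neq_above _)).
Qed.

Theorem theorem2p2 (lam mu : seq nat) (d : nat)
    (lam_partition : is_partition lam) (mu_partition : is_partition mu)
    (mu_in_lam : contained mu lam)
    (connected : edgewise_connected (skew_diagram lam mu))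
    (d_diagonals : num_diagonals (skew_diagram lam mu) = d) :
  set_bij (outside_decompositions (skew_diagram lam mu))
          (abstract_border_strips d)
          (cutting_strip (skew_diagram lam mu)).
Proof.
have cvx := skew_diagram_convex lam_partition mu_partition.
split.
- move=> Pi out; have [S cutS] := cutting_strip_exists connected cvx out.
  have [Sb cardS _] := cutS; exists S; split=> //; first by rewrite cardS.
  exact: cutting_strip_translation_class.
- move=> Pi Pi' /set_mem out /set_mem out'.
  exact: cutting_strip_inj.
- move=> _ [S [Sb cardS ->]]; rewrite -d_diagonals in cardS.
  have [Pi out cutS] := cutting_strip_surj connected cvx Sb cardS.
  by exists Pi => //; exact: cutting_strip_translation_class.
Qed.
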